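(* Let $k$ be an arbitrary field, let $A\in\mathrm{Mat}_{n\times n}(k)$ and let $A=A_1+A_2$ be its core-nilpotent decomposition. Let $N_u(A)$ be the nullspace of $A$. Then there are bijections $$A(1GD)\;\simeq\;\Big[\prod_{i=1}^{\mathrm{rk}(A_1)}N_u(A)\Big]\times\Big[\prod_{i=1}^{\mathrm{rk}(A_2)}N_u(A)\Big]\times\Big[\prod_{i=1}^{\dim N_u(A)}k^{\mathrm{rk}(A_2)}\Big]\;\simeq\;k^{[\dim N_u(A)]\cdot(\mathrm{rk}(A)+\mathrm{rk}(A_2))}.$$
   Context: The core-nilpotent decomposition of a square matrix $A$ is the unique decomposition $A=A_1+A_2$ with $\mathrm{rk}(A_1)=\mathrm{rk}(A_1^2)$, $A_2$ nilpotent, and $A_1A_2=A_2A_1=0$. The index $m=i(A)$ is the smallest positive integer with $\mathrm{rk}(A^m)=\mathrm{rk}(A^{m+1})$. A $\{1\}$-inverse of $A$ is $A^-\in\mathrm{Mat}_{n\times n}(k)$ with $AA^-A=A$. A G-Drazin inverse of $A$ is $A^{GD}\in\mathrm{Mat}_{n\times n}(k)$ with $AA^{GD}A=A$ and $A^{GD}A^m=A^mA^{GD}$. $A(1GD)$ is the set of 1GD inverses of $A$: matrices $X\in\mathrm{Mat}_{n\times n}(k)$ such that $XAX=X$, $XA=A^-A$ and $AX=AA^{GD}$ for some $\{1\}$-inverse $A^-$ and some G-Drazin inverse $A^{GD}$ of $A$ (equivalently, $X=A^-AA^{GD}$ for such $A^-$, $A^{GD}$). ''Bijection'' means bijection of sets;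 empty products are singletons. *)

(* Defs.v *)
From mathcomp Require Import all_boot all_order all_algebra.

Set Implicit Arguments.
Unset Strict Implicit.
Unset Printing Implicit Defensive.
Import GRing.Theory.
Local Open Scope ring_scope.

Definition core_nilpotent_decomposition (k : fieldType) (n : nat)
    (A A1 A2 : 'M[k]_n) : Prop :=
  [/\ A = A1 + A2,
      \rank A1 = \rank (A1 ^+ 2),
      exists p : nat, A2 ^+ p = 0,
      A1 *m A2 = 0
    & A2 *m A1 = 0].

Lemma ex_mx_index (k : fieldType) (n : nat) (A : 'M[k]_n) :
  exists m : nat, (0 < m)%N && (\rank (A ^+ m) == \rank (A ^+ m.+1)).
Proof.
have step j : (exists m : nat,
    (0 < m)%N && (\rank (A ^+ m) == \rank (A ^+ m.+1)))
    \/ (\rank (A ^+ j.+1) + j <= n)%N.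
  elim: j => [|j [IH|IH]]; [by right; rewrite addn0 rank_leq_row | by left |].
  case: (eqVneq (\rank (A ^+ j.+1)) (\rank (A ^+ j.+2))) => [E|E].
    by left; exists j.+1; rewrite E eqxx.
  right; apply: leq_trans IH; rewrite addnS -addSn leq_add2r.
  by rewrite ltn_neqAle eq_sym E exprS mxrankM_maxr.
by case: (step n.+1) => // H; move: (leq_trans (leq_addl _ _) H); rewrite ltnn.
Qed.

Definition mx_index (k : fieldType) (n : nat) (A : 'M[k]_n) : nat :=
  ex_minn (ex_mx_index A).

Definition one_inverse (k : fieldType) (n : nat) (A B : 'M[k]_n) : Prop :=
  A *m B *m A = A.

Definition GDrazin_inverse (k : fieldType) (n : nat) (A G : 'M[k]_n) : Prop :=
  A *m G *m A = A /\ G *m A ^+ mx_index A = A ^+ mx_index A *m G.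

Definition one_GD_inverse (k : fieldType) (n : nat) (A X : 'M[k]_n) : Prop :=
  X *m A *m X = X /\
  exists B G : 'M[k]_n,
    [/\ one_inverse A B, GDrazin_inverse A G, X *m A = B *m A
      & A *m X = A *m G].

(* The right (column) nullspace {v | A v = 0}; [kermx A] is the left one. *)
Definition nullspace (k : fieldType) (n : nat) (A : 'M[k]_n) :
    {vspace 'cV[k]_n} :=
  lker (linfun (mulmx A : 'cV[k]_n -> 'cV[k]_n)).

Lemma mem_nullspace (k : fieldType) (n : nat) (A : 'M[k]_n) (v : 'cV[k]_n) :
  (v \in nullspace A) = (A *m v == 0).
Proof. by rewrite memv_ker lfunE. Qed.

(* Main.v *)
(** A 1GD inverse of [A] is the same as a reflexive inverse [X] ([XAX = X],
    [AXA = A]) with [A1 X = E], where [E] is the core projector. For a full rank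
    factorization [A = L R], such an [X] is [Y Z] with [Y = X L] and [Z = R X];
    here [Y] and [Z] range independently over the affine spaces [R Y = 1] and
    [Z L = 1, E L Z = E], of dimensions [dim N * rk A] and [dim N * rk A2].
    So the set of 1GD inverses is in bijection with a vector space of the same
    dimension as the other two sides, and equidimensional spaces are in
    bijection. *)

Require Import Defs.
From mathcomp Require Import all_boot all_order all_algebra.
From mathcomp Require Import classical_sets functions.

Set Implicit Arguments.
Unset Strict Implicit.
Unset Printing Implicit Defensive.
Import GRing.Theory.
Local Open Scope classical_set_scope.
Local Open Scope ring_scope.

Import VectorInternalTheory.

Lemma vect_bij (k : fieldType) (U V : vectType k) :
  dim U = dim V -> exists f : U -> V, bijective f.
Proof.
move=> eUV; exists (fun u => r2v (castmx (erefl 1%N, eUV) (v2r u))).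
exists (fun v => r2v (castmx (erefl 1%N, esym eUV) (v2r v))) => x;
  by rewrite r2vK castmx_comp castmx_id v2rK.
Qed.

(** * Column kernels and the nullspace *)

Section ColumnKernel.
Variables (k : fieldType) (m n : nat) (A : 'M[k]_(m, n)).

Definition col_ker : 'M_(n, \rank (kermx A^T)) := (row_base (kermx A^T))^T.

Lemma mul_col_ker : A *m col_ker = 0.
Proof.
apply: trmx_inj; rewrite trmx_mul trmxK trmx0.
by apply/sub_kermxP; rewrite eq_row_base.
Qed.

Lemma col_ker_full : row_full col_ker.
Proof. by rewrite /row_full mxrank_tr; apply: row_base_free. Qed.

(** The columns of [col_ker] form a basis of the right kernel, so its left inverse [pinvmx col_ker]
    reads off coordinates there. *)
Lemma col_kerK p (V : 'M_(n, p)) :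
  A *m V = 0 -> col_ker *m (pinvmx col_ker *m V) = V.
Proof.
move=> AV0; have /submxP[D DV] : (V^T <= row_base (kermx A^T))%MS.
  by rewrite eq_row_base; apply/sub_kermxP; rewrite -trmx_mul AV0 trmx0.
have -> : V = col_ker *m D^T by rewrite -(trmxK V) DV trmx_mul.
by rewrite (mulmxA (pinvmx _)) mulVpmx ?mul1mx // col_ker_full.
Qed.

End ColumnKernel.

Lemma row_kerK (k : fieldType) (m n p : nat) (A : 'M[k]_(m, n)) (V : 'M_(p, m)) :
  V *m A = 0 -> V *m pinvmx (row_base (kermx A)) *m row_base (kermx A) = V.
Proof. by move=> VA0; rewrite mulmxKpV // eq_row_base; apply/sub_kermxP. Qed.

Lemma dim_nullspace (k : fieldType) (n : nat) (A : 'M[k]_n) :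
  \dim (nullspace A) = (n - \rank A)%N.
Proof.
set C := col_ker A; pose f := linfun (mulmx C : 'cV[k]_ _ -> 'cV[k]_n).
(* Multiplication by [C] is injective, so the dimension of its image is the number of columns of
   [C]. *)
have -> : nullspace A = limg f.
  apply/vspaceP => v; rewrite mem_nullspace; apply/eqP/memv_imgP => [Av0|[w _ ->]].
    by exists (pinvmx C *m v); rewrite ?memvf // lfunE /= col_kerK.
  by rewrite lfunE /= mulmxA mul_col_ker mul0mx.
rewrite limg_dim_eq ?dimvf /dim /= ?mxrank_ker ?mxrank_tr ?muln1 //.
apply/eqP; rewrite -subv0 capfv; apply/subvP => v.
rewrite memv_ker lfunE /= memv0 => /eqP Cv0.
by rewrite -[v]mul1mx -(mulVpmx (col_ker_full A)) -mulmxA Cv0 mulmx0.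
Qed.

(** * Full rank factorizations and the core projector *)

Lemma full_rank_factorization (k : fieldType) (m n : nat) (A : 'M[k]_(m, n)) :
  exists (r : nat) (L : 'M_(m, r)) (R : 'M_(r, n)),
    [/\ A = L *m R, row_full L, row_free R & r = \rank A].
Proof.
exists (\rank A), (col_base A), (row_base A).
by rewrite mulmx_base col_base_full row_base_free.
Qed.

(* [E] is the projector onto the image of the core part along the nilpotent
   generalized kernel, and [D] is the Drazin inverse of [A]. *)
Lemma core_projector (k : fieldType) (n : nat) (A A1 A2 : 'M[k]_n) :
    core_nilpotent_decomposition A A1 A2 ->
  exists E D : 'M[k]_n,
    (E *m A = A1 /\ A *m E = A1) /\
    [/\ A *m D = E, D *m A = E, E *m D = D & D *m E = D].
Proof.
case=> -> rkA1 _ A12 A21.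
have [r [L [R [LR Lf Rf rE]]]] := full_rank_factorization A1.
(* Cancelling the outer factors of [A1 ^+ 2 = L (R L) R] shows that [R L] has the rank of [A1],
   which is its size. *)
have RLu : R *m L \in unitmx.
  rewrite -row_free_unit /row_free.
  have -> : \rank (R *m L) = \rank (A1 ^+ 2).
    rewrite expr2 -mulmxE LR mulmxA -(mulmxA L) (mxrankMfree _ Rf).
    by rewrite (eqmxMfull _ Lf).
  by rewrite -rkA1 -rE.
have RA2 : R *m A2 = 0.
  by rewrite -[R]mul1mx -(mulVpmx Lf) -(mulmxA _ L) -LR -mulmxA A12 mulmx0.
have A2L : A2 *m L = 0.
  by rewrite -[L]mulmx1 -(mulmxVp Rf) (mulmxA L) -LR mulmxA A21 mul0mx.
set W := invmx (R *m L).
have WRL p (M : 'M_(p, r)) : M *m W *m R *m L = M.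
  by rewrite -!mulmxA mulVmx ?mulmx1.
have RLW p (M : 'M_(p, r)) : M *m R *m L *m W = M.
  by rewrite -(mulmxA M) -mulmxA mulmxV ?mulmx1.
have RA2K p (M : 'M_(p, r)) : M *m R *m (A1 + A2) = M *m R *m L *m R.
  by rewrite mulmxDr -(mulmxA M R A2) RA2 mulmx0 addr0 LR mulmxA.
have A2LK p (M : 'M_(r, p)) : (A1 + A2) *m (L *m M) = L *m R *m L *m M.
  by rewrite mulmxDl !mulmxA A2L mul0mx addr0 LR.
(* These are the projector onto the range of [A1] along its kernel, and the group inverse of
   [A1]. *)
exists (L *m W *m R), (L *m W *m W *m R); split; split.
- by rewrite RA2K WRL.
- by rewrite -mulmxA A2LK mulmxA RLW.
- by rewrite -!mulmxA A2LK !mulmxA RLW.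
- by rewrite RA2K WRL.
- by rewrite !mulmxA WRL.
- by rewrite !mulmxA WRL.
Qed.

(** * Ranks and powers relative to the core projector *)

Section CoreNilpotent.
Variables (k : fieldType) (n : nat) (A A1 A2 E D : 'M[k]_n).
Hypothesis hA : core_nilpotent_decomposition A A1 A2.
Hypotheses (EA : E *m A = A1) (AE : A *m E = A1).
Hypotheses (AD : A *m D = E) (DA : D *m A = E).
Hypotheses (ED : E *m D = D) (DE : D *m E = D).

Lemma core_proj_idem : E *m E = E.
Proof. by rewrite -{2 3}DA mulmxA ED. Qed.

Lemma core_mul_proj : A1 *m E = A1.
Proof. by rewrite -AE -mulmxA core_proj_idem. Qed.

Lemma mul_compl_proj : A *m (1%:M - E) = A2 /\ (1%:M - E) *m A = A2.
Proof.
have [-> _ _ _ _] := hA; rewrite mulmxBr mulmxBl mulmx1 mul1mx.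
have [<- _ _ _ _] := hA; rewrite AE EA; have [-> _ _ _ _] := hA.
by rewrite addrC addKr.
Qed.

Lemma mul_core_compl : A1 *m (1%:M - E) = 0.
Proof. by rewrite mulmxBr mulmx1 core_mul_proj subrr. Qed.

Lemma compl_proj_idem : (1%:M - E) *m (1%:M - E) = 1%:M - E.
Proof. by rewrite mulmxBl mul1mx mulmxBr mulmx1 core_proj_idem subrr subr0. Qed.

(** Right multiplication by [E] fixes [A1] and kills [A2], so their row spaces meet trivially; both
    lie in that of [A], since [A1 = E A] and [A2 = (1 - E) A]. *)
Lemma rank_core_nilpotent : \rank A = (\rank A1 + \rank A2)%N.
Proof.
have [AF FA] := mul_compl_proj; have [dA _ _ _ _] := hA.
have /mxrank_disjoint_sum <- : (A1 :&: A2 = 0)%MS.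
  apply/eqP/rowV0P => v; rewrite sub_capmx => /andP[/submxP[x ->] /submxP[y xy]].
  rewrite -core_mul_proj mulmxA xy -AF !mulmxA mulmxBr mulmx1 mulmxBl.
  by rewrite -!mulmxA core_proj_idem subrr.
apply/eqP; rewrite eqn_leq !mxrankS //; last by rewrite dA addmx_sub_adds.
by rewrite addsmx_sub -EA -FA !submxMl.
Qed.

Lemma mx_index_gt0 : (0 < mx_index A)%N.
Proof. by rewrite /mx_index; case: ex_minnP => m /andP[]. Qed.

(** Equal ranks at the index make the row spaces of two consecutive powers equal; multiplying by [A]
    propagates this to all later powers. *)
Lemma exp_index_submx j : (A ^+ mx_index A <= A ^+ (mx_index A + j))%MS.
Proof.
elim: j => [|j IH]; first by rewrite addn0.
have sA : (A ^+ mx_index A <= A ^+ (mx_index A).+1)%MS.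
  rewrite /mx_index; case: ex_minnP => m /andP[_ /eqP rkm] _.
  have sm : (A ^+ m.+1 <= A ^+ m)%MS by rewrite exprS -mulmxE submxMl.
  by rewrite -(mxrank_leqif_sup sm) rkm.
by apply: submx_trans IH _; rewrite addnS -addSn !exprD -!mulmxE submxMr.
Qed.

Lemma exp_mul_compl j : A ^+ j *m (1%:M - E) = A2 ^+ j *m (1%:M - E).
Proof.
have [AF FA] := mul_compl_proj.
have F2 : (1%:M - E) *m A2 = A2 by rewrite -FA mulmxA compl_proj_idem.
have A2F : A2 *m (1%:M - E) = A2 by rewrite -AF -mulmxA compl_proj_idem.
elim: j => [//|j IH]; rewrite !exprSr -!mulmxE -!mulmxA AF A2F -F2 mulmxA IH.
by rewrite -mulmxA F2.
Qed.

(** If [A2 ^+ p = 0], then [A ^+ p] kills [1 - E], and the power at the index is a left multiple of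
    a power divisible by [A ^+ p]. The index of [A] thus need not be compared with the nilpotency
    index of [A2]. *)
Lemma exp_index_proj : A ^+ mx_index A *m E = A ^+ mx_index A.
Proof.
have [_ _ [p A2p] _ _] := hA.
have /submxP[W ->] := exp_index_submx p.
rewrite exprD -mulmxE -!mulmxA; congr (_ *m (_ *m _)).
apply/esym/eqP; rewrite -subr_eq0 -{1}[A ^+ p]mulmx1 -mulmxBr.
by rewrite exp_mul_compl A2p mul0mx.
Qed.

Lemma proj_exp_index : E *m A ^+ mx_index A = A ^+ mx_index A.
Proof.
rewrite -{2}exp_index_proj; apply: commrX.
by rewrite /GRing.comm -!mulmxE EA AE.
Qed.

(** The product telescopes through [D E A = D A = E]. At [j = 0] it would be the identity
    instead. *)
Lemma proj_expE j : (0 < j)%N -> D ^+ j *m A ^+ j = E.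
Proof.
elim: j => [//|[_ _|j IH _]]; first by rewrite !expr1.
by rewrite (exprS D) (exprSr A) -!mulmxE mulmxA -(mulmxA D) IH // DE DA.
Qed.

(** * Characterization and parametrization of 1GD inverses *)

Lemma one_GD_inverseP X :
  one_GD_inverse A X <-> [/\ X *m A *m X = X, A *m X *m A = A & A1 *m X = E].
Proof.
split=> [[XAX [B [G [ABA [AGA GAm] XA AX]]]] | [XAX AXA A1X]].
  (* Commute [G] past the power, then use [A G A = A] with one factor of the power, available
     because the index is positive. Multiplying by a power of [D] then turns this into
     [E A G = E]. *)
  have AmAG : A ^+ mx_index A *m (A *m G) = A ^+ mx_index A.
    move: GAm AGA; rewrite -(prednK mx_index_gt0) !mulmxE => GAm AGA.
    by rewrite mulrA -exprSr exprS -mulrA -GAm exprS !mulrA AGA.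
  split=> //; first by rewrite AX.
  by rewrite -EA -mulmxA AX -(proj_expE mx_index_gt0) -mulmxA AmAG.
have AXE : A *m X *m E = E by rewrite -AD mulmxA AXA.
(* [X] serves as its own inner inverse. The G-Drazin inverse is [D] plus the compression of [X] to
   the nilpotent part; the compression is annihilated on both sides by the power of [A] at its
   index, so only [D] has to commute with it. *)
split=> //; exists X, (D + (1%:M - E) *m X *m (1%:M - E)).
have [AF FA] := mul_compl_proj.
have AG : A *m (D + (1%:M - E) *m X *m (1%:M - E)) = A *m X.
  rewrite (mulmxDr A) !mulmxA AD AF -FA mulmxBl mul1mx EA mulmxBl A1X.
  by rewrite mulmxBr mulmx1 mulmxBl AXE core_proj_idem subrr subr0 addrC subrK.
split=> //; split; first by rewrite AG.
have FAm : (1%:M - E) *m A ^+ mx_index A = 0.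
  by rewrite mulmxBl mul1mx proj_exp_index subrr.
have AmF : A ^+ mx_index A *m (1%:M - E) = 0.
  by rewrite mulmxBr mulmx1 exp_index_proj subrr.
rewrite (mulmxDl D) (mulmxDr _ D) -(mulmxA _ _ (A ^+ _)) FAm mulmx0.
rewrite !mulmxA AmF !mul0mx !addr0.
by apply: commrX; rewrite /GRing.comm -!mulmxE DA AD.
Qed.

(* [H] is a G-Drazin inverse assembled from the Drazin inverse and an inner
   inverse of the nilpotent part. *)
Lemma ex_one_GD_inverse : exists X : 'M_n, one_GD_inverse A X.
Proof.
have [AF FA] := mul_compl_proj.
have [B ABA] : exists B, A *m B *m A = A.
  by exists (pinvmx A); rewrite mulmxKpV.
pose H := D + (1%:M - E) *m B *m (1%:M - E).
have A2BA2 : A2 *m B *m A2 = A2.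
  rewrite -{1}FA -{1}AF mulmxA -2!(mulmxA (1%:M - E)) ABA FA.
  by rewrite -AF -mulmxA compl_proj_idem.
have AHA : A *m H *m A = A.
  rewrite (mulmxDr A) mulmxDl AD EA !mulmxA AF -(mulmxA _ _ A) FA A2BA2.
  by have [] := hA.
have HAHA : H *m A *m H *m A = H *m A by rewrite -2!(mulmxA H) AHA.
have A1H : A1 *m H = E.
  rewrite (mulmxDr A1) !mulmxA mul_core_compl !mul0mx addr0.
  by rewrite -EA -mulmxA AD core_proj_idem.
(* [H] need not satisfy [H A H = H]; passing to [H A H] enforces this and keeps the other two
   conditions. *)
exists (H *m A *m H); apply/one_GD_inverseP; split.
- by rewrite !mulmxA !HAHA.
- by rewrite !mulmxA !AHA.
- by rewrite !mulmxA A1H EA A1H.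
Qed.

(* The directions of the two affine spaces of [Y]'s and [Z]'s are the matrices
   [col_ker A *m U] and [col_ker (E *m L) *m W *m row_base (kermx A)]. *)
Lemma one_GD_inverse_param :
  exists (U : vectType k) (h : U -> 'M[k]_n) (g : 'M[k]_n -> U),
    [/\ dim U = ((n - \rank A) * (\rank A + \rank A2))%N,
        forall u, one_GD_inverse A (h u), cancel h g
      & forall X, one_GD_inverse A X -> h (g X) = X].
Proof.
have [X0 /one_GD_inverseP[_ AX0A A1X0]] := ex_one_GD_inverse.
have [r [L [R [LR Lf Rf rE]]]] := full_rank_factorization A.
have [L' L'L] : exists L', L' *m L = 1%:M by exists (pinvmx L); apply: mulVpmx.
have inv_fac X : A *m X *m A = A -> R *m (X *m L) = 1%:M.
  rewrite LR => AXA; apply: (can_inj (mulmxKp Rf)); rewrite mul1mx.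
  by have := congr1 (mulmx L') AXA; rewrite !mulmxA L'L !mul1mx.
pose C := col_ker A; pose K := col_ker (E *m L); pose H := row_base (kermx A).
have Cf : row_full C by apply: col_ker_full.
have Kf : row_full K by apply: col_ker_full.
have Hf : row_free H by apply: row_base_free.
have RC : R *m C = 0.
  by rewrite -[R]mul1mx -L'L -mulmxA -(mulmxA L') (mulmxA L) -LR mul_col_ker mulmx0.
have HL : H *m L = 0.
  have HA : H *m A = 0 by apply/sub_kermxP; rewrite eq_row_base.
  by rewrite -[L]mulmx1 -(mulmxVp Rf) (mulmxA L) -LR mulmxA HA mul0mx.
(* [X0] supplies the base points. Since [L] and [R] cancel, [R] has the right kernel of [A] and [L]
   its left kernel, so [C] and [H] span the homogeneous solutions of [R Y = 1] and [Z L = 1]; [K]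
   imposes [E L Z = E] as well. *)
pose Y u := X0 *m L + C *m u; pose Z w := R *m X0 + K *m w *m H.
have RY u : R *m Y u = 1%:M.
  by rewrite (mulmxDr R) inv_fac // mulmxA RC mul0mx addr0.
have ZL w : Z w *m L = 1%:M.
  by rewrite (mulmxDl (R *m X0)) -mulmxA inv_fac // -mulmxA HL mulmx0 addr0.
have ELZ w : E *m L *m Z w = E.
  rewrite (mulmxDr (E *m L)) !mulmxA mul_col_ker !mul0mx addr0.
  by rewrite -(mulmxA E) -LR EA A1X0.
pose c := \rank (kermx A^T); pose q := \rank (kermx (E *m L)^T).
pose d := \rank (kermx A).
exists ('M[k]_(c, r) * 'M[k]_(q, d))%type, (fun u => Y u.1 *m Z u.2).
exists (fun X => (pinvmx C *m (X *m L - X0 *m L),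
                  pinvmx K *m (R *m X - R *m X0) *m pinvmx H)); split.
(* Here [c = d = n - \rank A], while [E L] has the rank of [E L R = A1], so
   [q = \rank A - \rank A1 = \rank A2]. *)
- rewrite /dim /= /dim /= /c /d /q !mxrank_ker !mxrank_tr -(mxrankMfree _ Rf).
  rewrite -mulmxA -LR EA rE mulnDr; congr (_ + _)%N.
  by rewrite rank_core_nilpotent addKn mulnC.
- move=> [u w]; apply/one_GD_inverseP; split=> /=.
  + by rewrite LR !mulmxA -(mulmxA _ (Z w) L) ZL mulmx1 -(mulmxA _ R) RY mulmx1.
  + by rewrite LR !mulmxA -(mulmxA L) RY mulmx1 -(mulmxA L) ZL mulmx1.
  + by rewrite -EA LR !mulmxA -(mulmxA _ R) RY mulmx1 ELZ.
- move=> [u w] /=; rewrite -mulmxA ZL mulmx1 mulmxA RY mul1mx /Y /Z.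
  rewrite ![_ + _ - _]addrAC !subrr !add0r (mulmxA (pinvmx C)) mulVpmx // mul1mx.
  by rewrite -(mulmxA K) (mulmxA (pinvmx K)) mulVpmx // mul1mx mulmxKp.
- move=> X /one_GD_inverseP[XAX AXA A1X] /=.
  have -> : Y (pinvmx C *m (X *m L - X0 *m L)) = X *m L.
    rewrite /Y col_kerK ?subrKC // LR -mulmxA mulmxBr.
    by rewrite !inv_fac // subrr mulmx0.
  have -> : Z (pinvmx K *m (R *m X - R *m X0) *m pinvmx H) = R *m X.
    rewrite /Z -(mulmxA (pinvmx K) _ (pinvmx H)) -(mulmxA K).
    rewrite -(mulmxA (pinvmx K)) row_kerK; last first.
      rewrite LR mulmxA mulmxBl -!mulmxA.
      by rewrite !inv_fac // subrr mul0mx.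
    rewrite col_kerK ?subrKC // mulmxBr !mulmxA -(mulmxA E) -LR EA A1X A1X0.
    by rewrite subrr.
  by rewrite -mulmxA (mulmxA L) -LR mulmxA.
Qed.

End CoreNilpotent.

Theorem theorem3p24 (k : fieldType) (n : nat) (A A1 A2 : 'M[k]_n)
    (hA : core_nilpotent_decomposition A A1 A2) :
  let N := nullspace A in
  let middle : Type :=
    ({ffun 'I_(\rank A1) -> subvs_of N} *
     {ffun 'I_(\rank A2) -> subvs_of N} *
     {ffun 'I_(\dim N) -> 'cV[k]_(\rank A2)})%type in
  (exists f : 'M[k]_n -> middle,
     set_bij [set X | one_GD_inverse A X] [set: middle] f) /\
  (exists g : middle -> 'cV[k]_(\dim N * (\rank A + \rank A2)), bijective g).
Proof.
move=> N middle.
have [E [D [[EA AE] [AD DA ED DE]]]] := core_projector hA.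
have rkA : \rank A = (\rank A1 + \rank A2)%N.
  exact: (rank_core_nilpotent hA EA AE DA ED).
have [U [h [g [dU hS hK gK]]]] :=
  one_GD_inverse_param hA EA AE AD DA ED DE.
have dN : \dim N = (n - \rank A)%N by apply: dim_nullspace.
pose M : vectType k := ({ffun 'I_(\rank A1) -> subvs_of N} *
  {ffun 'I_(\rank A2) -> subvs_of N} *
  {ffun 'I_(\dim N) -> 'cV[k]_(\rank A2)})%type.
have dM : dim M = ((n - \rank A) * (\rank A + \rank A2))%N.
  do 4!rewrite /dim /=; rewrite !card_ord muln1 -mulnDl -rkA dN mulnDr.
  by rewrite (mulnC (\rank A)).
split; last first.
  by apply: (@vect_bij k M 'cV[k]_ _); rewrite dM /dim /= muln1 dN.
have [f [f' fK f'K]] : exists f : U -> M, bijective f.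
  by apply: vect_bij; rewrite dU dM.
(* [f \o g] is defined on all matrices, but [gK] makes it injective only on 1GD inverses; [h \o f']
   supplies preimages there. *)
exists (f \o g); split=> [//| X X' | v _].
  move=> /set_mem SX /set_mem SX' /= /(can_inj fK) gXX'.
  by rewrite -(gK X) // -(gK X') // gXX'.
by exists (h (f' v)); [apply: hS | rewrite /= hK f'K].
Qed.
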